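(* Let $\sigma$ and $\theta$ be finite substitutions and let $J$ be a non-trivial model of $\mathrm{FEA}(L)$. Then (1) $\sigma\preceq_J\theta$ iff $\sigma\preceq\theta$; (2) $\sigma\approx_J\theta$ iff $\sigma\approx\theta$.
   Context: $L$ is a first-order language with equality whose function symbols include at least one constant. $\mathrm{FEA}(L)$ (free equality axioms): $f(\bar x)=f(\bar y)\leftrightarrow x_1=y_1\wedge\dots\wedge x_n=y_n$; $f(\bar x)=g(\bar y)\leftrightarrow\mathit{False}$ for distinct $f,g$; $x=t\leftrightarrow\mathit{False}$ whenever $x\not\equiv t$ and $x$ occurs in $t$. A pre-interpretation $J$: nonempty domain $U_J$, interpretation of function symbols, $=$ identity; $V_J$ the set of $J$-valuations. $J$ is a non-trivial model of $\mathrm{FEA}(L)$ if its axioms are true in $J$ and $|U_J|\ge 2$. A finite substitution $\sigma$ maps a finite set $\mathrm{Dom}(\sigma)$ of variables to terms; $\mathrm{Range}(\sigma)$ is the set of variables in its values; $t\sigma$ is simultaneous replacement; composition $\sigma\tau$ (for $\mathrm{Range}(\sigma)\subseteq\mathrm{Dom}(\tau)$) is the substitution over $\mathrm{Dom}(\sigma)$ with $(\sigma\tau)(x)=\sigma(x)\tau$. $\mathrm{Inst}_J(\sigma)=\{h\in V_J:\exists g\in V_J\ \forall x\in\mathrm{Dom}(\sigma)\ h(x)=g(\sigma(x))\}$; $\sigma\preceq_J\theta$ iff $\mathrm{Inst}_J(\sigma)\subseteq\mathrm{Inst}_J(\theta)$, $\sigma\approx_J\theta$ iff equality. $\theta$ is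 a regular extension of $\sigma$ if $\mathrm{Dom}(\sigma)\subseteq\mathrm{Dom}(\theta)$, $\theta$ agrees with $\sigma$ on $\mathrm{Dom}(\sigma)$, and $\theta$ maps $\mathrm{Dom}(\theta)\setminus\mathrm{Dom}(\sigma)$ injectively into variables not in $\mathrm{Range}(\sigma)$. $\sigma\preceq\theta$ iff there is $\tau$ with $\sigma'=\theta'\tau$ for some regular extensions $\sigma'$ of $\sigma$ and $\theta'$ of $\theta$ with the same domain; $\sigma\approx\theta$ iff $\sigma\preceq\theta$ and $\theta\preceq\sigma$. *)

(* Defs.v *)
From mathcomp Require Import all_boot finmap.
From mathcomp Require Import boolp classical_sets.

Set Implicit Arguments.
Unset Strict Implicit.
Unset Printing Implicit Defensive.

(* Predicate symbols other than equality are left out of the signature: terms,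
   substitutions, pre-interpretations and the free equality axioms do not
   mention them. *)
Record language := Language {
  symbol : Type;
  arity : symbol -> nat;
  has_constant : exists c : symbol, arity c = 0 }.

Definition variable := nat.

(* Arguments are a finite function, so that Leibniz equality of terms is
   syntactic identity. *)
Inductive term (L : language) : Type :=
  | Var of variable
  | App (f : symbol L) of {ffun 'I_(arity f) -> term L}.

Arguments Var {L} _.
Arguments App {L} f _.

Fixpoint tvars (L : language) (t : term L) : {fset variable} :=
  match t with
  | Var x => [fset x]%fset
  | App f a => (\big[fsetU/fset0]_(i < arity f) tvars (a i))%fset
  end.

(* The fragment of the first-order formulas of L in which the free equality
   axioms are written. *)
Inductive formula (L : language) : Type :=
  | FEq of term L & term L
  | FTrue
  | FFalse
  | FAnd of formula L & formula L
  | FIff of formula L & formula L.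

Arguments FEq {L} _ _.
Arguments FTrue {L}.
Arguments FFalse {L}.
Arguments FAnd {L} _ _.
Arguments FIff {L} _ _.

(* The tuples of distinct variables x_1 .. x_n and y_1 .. y_m of the axioms are
   Var 0 .. Var (n - 1) and Var n .. Var (n + m - 1). *)
Inductive FEA (L : language) : formula L -> Prop :=
  | FEA_inj (f : symbol L) :
      FEA (FIff (FEq (App f [ffun i : 'I_(arity f) => Var i])
                     (App f [ffun i : 'I_(arity f) => Var (arity f + i)]))
                (\big[FAnd/FTrue]_(i < arity f)
                   FEq (Var i) (Var (arity f + i))))
  | FEA_clash (f g : symbol L) of f <> g :
      FEA (FIff (FEq (App f [ffun i : 'I_(arity f) => Var i])
                     (App g [ffun j : 'I_(arity g) => Var (arity f + j)]))
                FFalse)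
  | FEA_occurs (x : variable) (t : term L) of Var x <> t & x \in tvars t :
      FEA (FIff (FEq (Var x) t) FFalse).

Record preinterp (L : language) := PreInterp {
  univ : Type;
  univ_inhabited : inhabited univ;
  fint : forall f : symbol L, {ffun 'I_(arity f) -> univ} -> univ }.

Definition valuation (L : language) (J : preinterp L) := variable -> univ J.

Fixpoint teval (L : language) (J : preinterp L) (h : valuation J) (t : term L) :
    univ J :=
  match t with
  | Var x => h x
  | App f a => fint [ffun i : 'I_(arity f) => teval h (a i)]
  end.

Fixpoint sat (L : language) (J : preinterp L) (h : valuation J)
    (A : formula L) : Prop :=
  match A with
  | FEq t u => teval h t = teval h u
  | FTrue => True
  | FFalse => False
  | FAnd B C => sat h B /\ sat h C
  | FIff B C => sat h B <-> sat h C
  end.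

(* Free variables of an axiom are implicitly universally quantified. *)
Definition true_in (L : language) (J : preinterp L) (A : formula L) : Prop :=
  forall h : valuation J, sat h A.

Definition nontrivial_model (L : language) (J : preinterp L) : Prop :=
  (forall A : formula L, FEA A -> true_in J A) /\
  exists a b : univ J, a <> b.

(* The domain of a substitution s is the finite set (domf s). *)
Definition substitution (L : language) := {fmap variable -> term L}.

Definition srange (L : language) (s : substitution L) : {fset variable} :=
  (\big[fsetU/fset0]_(x : domf s) tvars (s x))%fset.

(* A variable outside the domain of s is left unchanged; this clause is never
   used when the variables of t lie in the domain, as in a composition. *)
Fixpoint tsubst (L : language) (s : substitution L) (t : term L) : term L :=
  match t with
  | Var x => odflt (Var x) s.[? x]%fmap
  | App f a => App f [ffun i : 'I_(arity f) => tsubst s (a i)]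
  end.

Definition composable (L : language) (s t : substitution L) : Prop :=
  (srange s `<=` domf t)%fset.

(* Meaningful only when (composable s t). *)
Definition scomp (L : language) (s t : substitution L) : substitution L :=
  [fmap x : domf s => tsubst t (s x)]%fmap.

Definition Inst (L : language) (J : preinterp L) (s : substitution L) :
    set (valuation J) :=
  [set h : valuation J | exists g : valuation J,
     forall x : domf s, h (val x) = teval g (s x)]%classic.

Arguments Inst {L} J s _.

Definition le_in (L : language) (J : preinterp L) (s t : substitution L) : Prop :=
  (Inst J s `<=` Inst J t)%classic.

Definition equiv_in (L : language) (J : preinterp L) (s t : substitution L) : Prop :=
  Inst J s = Inst J t.

Definition regular_extension (L : language) (t s : substitution L) : Prop :=
  [/\ (domf s `<=` domf t)%fset,
      {in domf s, forall x : variable, t.[? x]%fmap = s.[? x]%fmap},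
      {in (domf t `\` domf s)%fset, forall x : variable,
         exists2 y : variable, t.[? x]%fmap = Some (Var y) & y \notin srange s}
    & {in (domf t `\` domf s)%fset &, injective (fun x : variable => t.[? x]%fmap)}].

Definition le_subst (L : language) (s t : substitution L) : Prop :=
  exists tau s' t' : substitution L,
    [/\ regular_extension s' s, regular_extension t' t, domf s' = domf t',
        composable t' tau & s' = scomp t' tau].

Definition equiv_subst (L : language) (s t : substitution L) : Prop :=
  le_subst s t /\ le_subst t s.

(* Main.v *)
(* A regular extension has the same J-instances as the substitution it extends,
   and a composition t tau has fewer J-instances than t: this gives the
   direction from the syntactic to the semantic order, in every J.
   Conversely, extend sigma and theta regularly to a common domain. Inclusion of
   the J-instances says that the matching problem theta' x = sigma' x (x in the
   domain), with the variables of sigma' held fixed, is solvable in J under every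
   valuation of those variables. In a non-trivial model of FEA(L) each way in
   which syntactic matching can fail is refuted by some valuation: a clash by
   the axioms; an application facing a variable because no function is
   surjective (some other value exists, thanks to the constant); two distinct
   terms bound to the same variable because distinct terms are separated by a
   valuation. *)
From mathcomp Require Import all_boot finmap.
From mathcomp Require Import boolp classical_sets.
Require Import Defs.

Set Implicit Arguments.
Unset Strict Implicit.
Unset Printing Implicit Defensive.

(** * Terms, regular extensions and matching positions *)

Section Terms.
Variable L : language.

(* The generated principle has no hypothesis for the arguments of App. *)
Definition term_args_ind (P : term L -> Prop)
    (PVar : forall x, P (Var x))
    (PApp : forall f (a : {ffun 'I_(arity f) -> term L}),
       (forall i, P (a i)) -> P (App f a)) : forall t, P t :=
  fix IH t := match t with
              | Var x => PVar x
              | App f a => PApp f a (fun i => IH (a i))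
              end.

Lemma tvars_arg f (a : {ffun 'I_(arity f) -> term L}) i y :
  y \in tvars (a i) -> y \in tvars (App f a).
Proof.
by move=> yai; apply/bigfcupP; exists i => //; rewrite mem_index_enum.
Qed.

Lemma tvars_srange (s : substitution L) x u y :
  s.[? x]%fmap = Some u -> y \in tvars u -> y \in srange s.
Proof.
case: fndP => // xs [<-] yu; apply/bigfcupP.
by exists [` xs]%fset => //; rewrite mem_index_enum.
Qed.

Lemma regular_extension_exists (s : substitution L) (D : {fset variable}) :
  (domf s `<=` D)%fset ->
  exists2 s' : substitution L, regular_extension s' s & domf s' = D.
Proof.
(* [N] exceeds every variable of the range, so [N + x] is fresh, and injective in [x]. *)
move=> sD; pose N := (\sum_(y <- srange s) y).+1.
have ltN y : y \in srange s -> y < N.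
  by move=> ys; rewrite ltnS (big_rem y) //= leq_addr.
pose s' : substitution L := [fmap x : D => odflt (Var (N + val x)) s.[? val x]]%fmap.
have s'E x : x \in D -> s'.[? x]%fmap = Some (odflt (Var (N + x)) s.[? x]%fmap).
  by move=> xD; rewrite in_fnd ffunE.
have s'new x : x \in (D `\` domf s)%fset -> s'.[? x]%fmap = Some (Var (N + x)).
  by rewrite in_fsetD => /andP[xs xD]; rewrite s'E // not_fnd.
exists s' => //; split=> //.
- by move=> x xs; rewrite s'E ?(fsubsetP sD) // in_fnd.
- move=> x xD; exists (N + x); first exact: s'new.
  by apply/negP => /ltN; rewrite ltnNge leq_addr.
- by move=> x x' xD x'D; rewrite !s'new // => -[] /addnI.
Qed.

(* [match_at p q y r]: the variable y occurs in p at a position where q has the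
   subterm r. *)
Inductive match_at : term L -> term L -> variable -> term L -> Prop :=
  | match_at_var y q : match_at (Var y) q y q
  | match_at_app f (a b : {ffun 'I_(arity f) -> term L}) i y r :
      match_at (a i) (b i) y r -> match_at (App f a) (App f b) y r.

Lemma match_at_tvars p q y r : match_at p q y r -> y \in tvars p.
Proof.
elim=> [z _|f a b i z r' _]; first by rewrite /= in_fset1.
exact: tvars_arg.
Qed.

End Terms.

(** * Instances in a pre-interpretation *)

Section Semantics.
Variables (L : language) (J : preinterp L).
Implicit Types (g h : valuation J) (s t : substitution L).

Lemma eq_in_teval g g' (t : term L) :
  {in tvars t, g =1 g'} -> teval g t = teval g' t.
Proof.
elim/term_args_ind: t => [x|f a IH] eqg /=; first by rewrite eqg ?in_fset1.
congr fint; apply/ffunP => i; rewrite !ffunE; apply: IH => y yai.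
exact/eqg/tvars_arg/yai.
Qed.

Lemma teval_tsubst g s (t : term L) :
  teval g (tsubst s t) =
  teval (fun y => teval g (odflt (Var y) s.[? y]%fmap)) t.
Proof.
elim/term_args_ind: t => [x|f a IH] //=.
by congr fint; apply/ffunP => i; rewrite !ffunE.
Qed.

Lemma InstP s h :
  Inst J s h <-> exists g, forall x u, s.[? x]%fmap = Some u -> h x = teval g u.
Proof.
split=> -[g hg]; exists g; last by move=> x; apply: hg; rewrite Some_fnd.
by move=> x u; case: fndP => // xs [<-]; apply: (hg [` xs]%fset).
Qed.

Lemma Inst_regular_extension s t :
  regular_extension t s -> Inst J t = Inst J s.
Proof.
case=> [st agree fresh inj]; apply/seteqP; split=> h /InstP[g hg]; apply/InstP.
  exists g => x u sx; apply: hg; rewrite agree //.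
  by rewrite -fndSome sx.
pose new y x := x \in (domf t `\` domf s)%fset /\ t.[? x]%fmap = Some (Var y).
(* The witness [g] is changed only at images of added variables. These avoid [srange s], so old
   values survive; injectivity of the extension makes the chosen preimage equal to [x]. *)
exists (fun y => if pselect (exists x, new y x) is left e
                 then h (projT1 (cid e)) else g y) => x u tx.
have xt : x \in domf t by rewrite -fndSome tx.
have [xs|xs] := boolP (x \in domf s).
  have sx : s.[? x]%fmap = Some u by rewrite -agree.
  rewrite (hg _ _ sx); apply: eq_in_teval => y yu.
  case: pselect => // e; exfalso; case: e => x' [/fresh[z -> zs] [zy]].
  by rewrite zy (tvars_srange sx yu) in zs.
have xD : x \in (domf t `\` domf s)%fset by rewrite in_fsetD xs.
have [y] := fresh _ xD; rewrite tx => -[uy] _; rewrite uy /= in tx *.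
case: pselect => [e|[]]; last by exists x.
case: (cid e) => x' [x'D tx'] /=; congr h.
by apply: inj => //; rewrite tx tx'.
Qed.

Lemma Inst_scomp s t : (Inst J (scomp s t) `<=` Inst J s)%classic.
Proof.
(* Evaluating after substituting by [t] is evaluating under the valuation [t] followed by [g]. *)
move=> h [g hg]; exists (fun y => teval g (odflt (Var y) t.[? y]%fmap)) => x.
by rewrite -teval_tsubst (hg x) ffunE.
Qed.

Lemma le_subst_le_in s t : le_subst s t -> le_in J s t.
Proof.
case=> [tau [s' [t' [es et _ _ s'E]]]].
rewrite /le_in -(Inst_regular_extension es) -(Inst_regular_extension et) s'E.
exact: Inst_scomp.
Qed.

Lemma sat_big_and h (I : eqType) (r : seq I) (F : I -> formula L) i :
  sat h (\big[FAnd/FTrue]_(j <- r) F j) -> i \in r -> sat h (F i).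
Proof.
elim: r => [|j r IH] //; rewrite big_cons in_cons => -[Fj Fr].
by case/orP=> [/eqP->|/(IH Fr)].
Qed.

(** Lets the axioms, stated for the variables [0 .. n + m - 1], speak about arbitrary argument
    tuples of the domain. *)
Lemma valuation_of_args n m (a : {ffun 'I_n -> univ J})
    (b : {ffun 'I_m -> univ J}) :
  exists h : valuation J,
    (forall i : 'I_n, h i = a i) /\ (forall j : 'I_m, h (n + j) = b j).
Proof.
have [e] := univ_inhabited J.
exists (fun x => if insub x is Some i then a i
                 else if insub (x - n) is Some j then b j else e).
split=> [i|j]; first by rewrite valK.
by rewrite insubN ?ltnNge ?leq_addr // addKn valK.
Qed.

(** * Separation and matching in a non-trivial model *)

Section NontrivialModel.
Hypothesis hJ : nontrivial_model J.

Lemma fint_inj (f : symbol L) : injective (@fint L J f).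
Proof.
move=> a b eqab; have [h [ha hb]] := valuation_of_args a b.
have /= [inj _] := hJ.1 _ (FEA_inj f) h.
suff args : sat h (\big[FAnd/FTrue]_(i < arity f)
                     FEq (Var i) (Var (arity f + i))).
  apply/ffunP => i; rewrite -ha -hb.
  exact: (sat_big_and args (mem_index_enum i)).
apply: inj.
have -> : [ffun i => teval h ([ffun i0 : 'I_(arity f) => Var i0] i)] = a.
  by apply/ffunP => i; rewrite !ffunE /= ha.
have -> // : [ffun i => teval h ([ffun i0 : 'I_(arity f) =>
                                    Var (arity f + i0)] i)] = b.
by apply/ffunP => i; rewrite !ffunE /= hb.
Qed.

Lemma fint_clash (f f' : symbol L) a b :
  f <> f' -> fint (f := f) a <> fint (f := f') b :> univ J.
Proof.
move=> neq eqab; have [h [ha hb]] := valuation_of_args a b.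
have /= [clash _] := hJ.1 _ (FEA_clash neq) h; apply: clash.
have -> : [ffun i => teval h ([ffun i0 : 'I_(arity f) => Var i0] i)] = a.
  by apply/ffunP => i; rewrite !ffunE /= ha.
have -> // : [ffun i => teval h ([ffun i0 : 'I_(arity f') =>
                                    Var (arity f + i0)] i)] = b.
by apply/ffunP => i; rewrite !ffunE /= hb.
Qed.

Lemma exists_other (e : univ J) : exists e', e' <> e.
Proof.
have [_ [a [b ab]]] := hJ.
by case: (pselect (a = e)) => [<-|]; [exists b; apply/nesym | exists a].
Qed.

(** If [f] is not the constant [c], the value of [c] is missed by the clash axiom; if it is, [f]
    takes a single value. *)
Lemma fint_not_surj (f : symbol L) :
  exists e : univ J, forall a, fint (f := f) a <> e.
Proof.
have [[c c0] [e0]] := (has_constant L, univ_inhabited J).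
case: (pselect (f = c)) => [fc|fc]; last first.
  by exists (fint [ffun _ : 'I_(arity c) => e0]) => a; apply: fint_clash.
have [e neq] := exists_other (fint [ffun _ : 'I_(arity f) => e0]).
exists e => a ae; apply: neq; rewrite -ae; congr fint.
by apply/ffunP => -[i ilt]; exfalso; rewrite fc c0 in ilt.
Qed.

(** If [x] occurs in [t], the occurs axiom makes any valuation work; otherwise [x] can be revalued
    without affecting [t]. *)
Lemma separate_var x (t : term L) :
  Var x <> t -> exists g, g x <> teval g t.
Proof.
move=> neq; have [e] := univ_inhabited J; pose g0 : valuation J := fun=> e.
have [xt|xt] := boolP (x \in tvars t).
  by exists g0 => eqx; have [occ _] := hJ.1 _ (FEA_occurs neq xt) g0; apply: occ.
have [e' neq'] := exists_other (teval g0 t).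
exists (fun y => if y == x then e' else g0 y).
rewrite eqxx -(@eq_in_teval g0) // => y yt.
by case: eqP yt xt => // -> ->.
Qed.

Lemma separate_terms (u v : term L) :
  u <> v -> exists g, teval g u <> teval g v.
Proof.
elim/term_args_ind: u v => [x|f a IH] [y|f' b] neq.
- exact: separate_var.
- exact: separate_var.
- have [g gP] := separate_var (nesym neq); exists g; exact: nesym gP.
- case: (pselect (f = f')) => [eqf|neqf].
    subst f'; have [i neqi] : exists i, a i <> b i.
      by apply/existsNP => eqab; apply: neq; congr App; apply/ffunP.
    have [g gP] := IH i _ neqi; exists g => /= /fint_inj/ffunP/(_ i).
    by rewrite !ffunE.
  have [e] := univ_inhabited J.
  by exists (fun=> e) => /=; apply: fint_clash.
Qed.

Lemma match_at_teval (p q : term L) y r g g' :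
  match_at p q y r -> teval g q = teval g' p -> g' y = teval g r.
Proof.
elim=> [//|f a b i z r' _ IH /= /fint_inj/ffunP/(_ i)].
by rewrite !ffunE.
Qed.

Lemma tsubst_match (p q : term L) (tau : substitution L) :
  (forall g, exists g', teval g q = teval g' p) ->
  (forall y r, match_at p q y r -> tau.[? y]%fmap = Some r) ->
  tsubst tau p = q.
Proof.
elim/term_args_ind: p q => [x|f a IH] q solv tauP /=.
  by rewrite (tauP x q) //; constructor.
case: q solv tauP => [z|f' b] solv tauP.
  (* An application facing a variable: give that variable a value outside the range of [f]. *)
  have [e eP] := fint_not_surj f.
  by have [g' /= /esym/eP] := solv (fun=> e).
case: (pselect (f = f')) => [eqf|neqf]; last first.
  have [e] := univ_inhabited J.
  by have [g' /= /esym] := solv (fun=> e); case/fint_clash.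
subst f'; congr App; apply/ffunP => i; rewrite ffunE; apply: IH.
  move=> g; have [g' /= /fint_inj/ffunP/(_ i)] := solv g.
  by rewrite !ffunE => ?; exists g'.
by move=> y r yr; apply: tauP; apply: match_at_app yr.
Qed.

(** [tau] collects the bindings [R] that matching [t] against [s] demands. *)
Lemma le_in_scomp s t :
  domf s = domf t -> le_in J s t ->
  exists2 tau, composable t tau & s = scomp t tau.
Proof.
move=> dom le.
(* The valuation [s] followed by [g] is an instance of [s], hence of [t]; one [g'] thus serves all
   [x] at once. *)
have solv g : exists g', forall x u v, s.[? x]%fmap = Some u ->
    t.[? x]%fmap = Some v -> teval g u = teval g' v.
  have [|g' hg'] := (InstP t (fun x => teval g (odflt (Var x) s.[? x]%fmap))).1.
    by apply: le; apply/InstP; exists g => x u ->.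
  by exists g' => x u v su tv; rewrite -(hg' _ _ tv) su.
pose R y r := exists x u v,
  [/\ s.[? x]%fmap = Some u, t.[? x]%fmap = Some v & match_at v u y r].
(* Under each [g], both [r] and [r'] take the value [g' y], so no valuation separates them. *)
have R_fun y r r' : R y r -> R y r' -> r = r'.
  move=> [x [u [v [su tv vu]]]] [x' [u' [v' [su' tv' vu']]]].
  apply: contrapT => /separate_terms[g]; apply; have [g' g'P] := solv g.
  rewrite -(match_at_teval vu (g'P _ _ _ su tv)).
  exact: match_at_teval vu' (g'P _ _ _ su' tv').
(* The default [Var 0] makes [tau] total on [srange t], before every variable there is known to have
   a binding. *)
pose tau : substitution L := [fmap y : srange t =>
  if pselect (exists r, R (val y) r) is left e then projT1 (cid e)
  else Var 0]%fmap.
exists tau; first exact: fsubset_refl.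
have tauP y r : R y r -> tau.[? y]%fmap = Some r.
  move=> yr; have yt : y \in srange t.
    case: (yr) => x [u [v [_ tv vu]]].
    exact: tvars_srange tv (match_at_tvars vu).
  rewrite in_fnd ffunE /=; case: pselect => [e|[]]; last by exists r.
  by case: (cid e) => r' yr' /=; congr Some; apply: R_fun yr.
apply/fmapP => x; have [xt|xt] := boolP (x \in domf t); last first.
  have xs : x \notin domf s by rewrite dom.
  by rewrite (not_fnd xs) (not_fnd (xt : x \notin domf (scomp t tau))).
have xs : x \in domf s by rewrite dom.
rewrite (in_fnd xs) (in_fnd (xt : x \in domf (scomp t tau))) ffunE; congr Some.
have tx : t.[? x]%fmap = Some t.[xt]%fmap by rewrite in_fnd.
have -> : t [` (xt : x \in domf (scomp t tau))]%fset = t.[xt]%fmap by [].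
apply/esym/tsubst_match => [g|y r yr].
  by have [g' g'P] := solv g; exists g'; apply: g'P tx; rewrite in_fnd.
by apply: tauP; exists x, s.[xs]%fmap, t.[xt]%fmap; split; rewrite ?in_fnd.
Qed.

Lemma le_in_le_subst s t : le_in J s t -> le_subst s t.
Proof.
move=> le.
have [s' es ds] := regular_extension_exists (fsubsetUl (domf s) (domf t)).
have [t' et dt] := regular_extension_exists (fsubsetUr (domf s) (domf t)).
have dst : domf s' = domf t' by rewrite ds dt.
have [|tau ct s'E] := @le_in_scomp s' t' dst.
  by rewrite /le_in (Inst_regular_extension es) (Inst_regular_extension et).
by exists tau, s', t'.
Qed.

End NontrivialModel.
End Semantics.

Theorem theorem5p10 (L : language) (J : preinterp L) (sigma theta : substitution L)
    (hJ : nontrivial_model J) :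
  (le_in J sigma theta <-> le_subst sigma theta) /\
  (equiv_in J sigma theta <-> equiv_subst sigma theta).
Proof.
have leP s t : le_in J s t <-> le_subst s t.
  by split; [exact: le_in_le_subst | exact: le_subst_le_in].
split=> //; rewrite /equiv_in /equiv_subst; split=> [eqst|[/leP st /leP ts]].
  by split; apply/leP; rewrite /le_in eqst.
exact/seteqP.
Qed.
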